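(* For any odd prime $p$, we have the identity $$\left(\frac{-1}{p}\right)\sum_{c=1}^{p-1}\left(\frac{c^3+c^2+c}{p}\right)-\sum_{b=1}^{p-1}\left(\frac{\left(b^2+1\right)\left(b^2+4b+1\right)}{p}\right)=2,$$ where $\left(\frac{*}{p}\right)$ denotes the Legendre symbol modulo $p$.
   Context: For an odd prime $p$ and an integer $n$, $\left(\frac{n}{p}\right)$ is the Legendre symbol modulo $p$, with the usual convention that it equals $0$ when $p\mid n$. The sums are over integers $c$ and $b$ from $1$ to $p-1$, and the identity is an equality of integers. *)

(* Defs.v *)
From mathcomp Require Import all_boot all_order all_algebra.
Set Implicit Arguments.
Unset Strict Implicit.
Unset Printing Implicit Defensive.

Local Open Scope ring_scope.

(* The Legendre symbol (n / p), intended for p an odd prime. A square root of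
   n modulo p may be sought among the representatives 0, ..., p - 1, which
   makes the test boolean. *)
Definition legendre (n : int) (p : nat) : int :=
  if (p%:Z %| n)%Z then 0
  else if [exists x : 'I_p, ((x : nat)%:Z ^+ 2 == n %[mod p%:Z])%Z] then 1
  else -1.

(* Main.v *)
Require Import Defs.
From mathcomp Require Import all_boot all_order all_algebra.
From mathcomp Require Import ring.

Import GRing.Theory Num.Theory.

Local Open Scope ring_scope.

(** Let chi be the quadratic character of 'F_p. Dividing the two arguments by
    the squares c^2 and b^2 turns them into c + 1/c + 1 and s^2 + 4 s, where
    s = b + 1/b, and x + 1/x = t has 1 + chi (t^2 - 4) solutions. Since chi
    sums to 0 and chi (t^2 + 4 t) sums to -1, the first term of the identity is
    sum_t chi ((t + 1) (4 - t^2)), while the second sum is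
    -1 + sum_t chi (t (t + 4) (t^2 - 4)). The substitution t -> 4 / t carries
    this quartic sum, whose term at t = 0 vanishes, to the cubic one without
    its term chi 4 = 1 at t = 0. *)

Section QuadraticCharacter.

Variable F : finFieldType.
Implicit Types (a c t u x y : F) (g : F -> int).

Definition quad_char x : int :=
  if x == 0 then 0 else if [exists y, y ^+ 2 == x] then 1 else -1.

Local Notation chi := quad_char.

Lemma quad_char0 : chi 0 = 0.
Proof. by rewrite /quad_char eqxx. Qed.

Lemma quad_char_sqr y : y != 0 -> chi (y ^+ 2) = 1.
Proof.
move=> y0; rewrite /quad_char expf_eq0 /= (negPf y0).
by case: existsP => // -[]; exists y.
Qed.

Lemma quad_char1 : chi 1 = 1.
Proof. by rewrite -(expr1n F 2) quad_char_sqr ?oner_eq0. Qed.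

Lemma quad_charMsqr x y : y != 0 -> chi (x * y ^+ 2) = chi x.
Proof.
move=> y0; rewrite /quad_char mulf_eq0 expf_eq0 /= (negPf y0) orbF.
case: eqP => // _; congr (if _ then _ else _).
apply/existsP/existsP => -[z /eqP ez].
  by exists (z / y); rewrite expr_div_n ez mulfK // expf_neq0.
by exists (z * y); rewrite exprMn ez.
Qed.

Hypothesis two_neq0 : 2 != 0 :> F.

Lemma four_neq0 : 4 != 0 :> F.
Proof. by rewrite (_ : 4 = 2 * 2) ?mulf_neq0 //; ring. Qed.

Lemma sum_sqrts a : \sum_(x : F | x ^+ 2 == a) 1 = 1 + chi a :> int.
Proof.
rewrite /quad_char; case: eqP => [->|/eqP a0].
  by rewrite (big_pred1 0) // => x; rewrite expf_eq0.
case: existsP => [[y /eqP ya]|nex]; last first.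
  by rewrite big1 // => x xa; case: nex; exists x.
have y0 : y != 0 by apply: contraNneq a0 => y0; rewrite -ya y0 expr0n.
rewrite (bigD1 y) /=; last by rewrite ya.
rewrite (big_pred1 (- y)) // => x /=.
rewrite -ya eqf_sqr; case: (eqVneq x y) => [->|]; last by rewrite andbT.
(* The roots [y] and [- y] are distinct because [2 * y] is nonzero. *)
rewrite /=; apply/esym/negbTE; rewrite -subr_eq0 opprK.
by rewrite (_ : y + y = 2 * y) ?mulf_neq0 //; ring.
Qed.

Lemma sum_affine a c g : a != 0 -> \sum_(x : F) g (a * x + c) = \sum_x g x.
Proof.
move=> a0; rewrite [RHS](reindex_inj (h := fun x => a * x + c)) //.
by move=> x y /addIr /(mulfI a0).
Qed.

Lemma sum_scale a g : a != 0 -> \sum_(x : F) g (a * x) = \sum_x g x.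
Proof.
by move=> a0; rewrite -(sum_affine a 0 g a0); under [RHS]eq_bigr do rewrite addr0.
Qed.

Lemma sum_neq0_inv g :
  \sum_(x : F | x != 0) g x^-1 = \sum_(x | x != 0) g x.
Proof.
rewrite [RHS](reindex_inj (h := GRing.inv)); last exact: invr_inj.
by apply: eq_bigl => x; rewrite invr_eq0.
Qed.

Lemma sum_neq0 g : \sum_(x : F | x != 0) g x = \sum_x g x - g 0.
Proof. by rewrite [in RHS](bigD1 0) //= [RHS]addrC addKr. Qed.

(** Sorting the elements of [F] by their squares gives |F| = sum_a (1 + chi a) = |F| + sum_a chi
    a. *)
Lemma sum_quad_char : \sum_x chi x = 0.
Proof.
have : \sum_a \sum_(x : F | x ^+ 2 == a) 1 = \sum_(x : F) 1 :> int.
  by rewrite [RHS](partition_big (fun x => x ^+ 2) predT).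
under eq_bigr do rewrite sum_sqrts.
by rewrite big_split /= => /eqP; rewrite addrC -subr_eq0 addrK => /eqP.
Qed.

(* For a non-square c, the terms chi (c x) + chi x sum to 0 and are all
   nonpositive, so they all vanish. *)
Lemma quad_charM : {morph chi : x y / x * y}.
Proof.
move=> c; case: (eqVneq c 0) => [-> x|c0]; first by rewrite !mul0r quad_char0 mul0r.
case: (boolP [exists y, y ^+ 2 == c]) => [/existsP[y /eqP yc] x|nsq].
  have y0 : y != 0 by apply: contraNneq c0 => y0; rewrite -yc y0 expr0n.
  by rewrite -yc mulrC quad_charMsqr // quad_char_sqr // mul1r.
have cN1 : chi c = -1 by rewrite /quad_char (negPf c0) (negPf nsq).
have le0 x : 0 <= - (chi (c * x) + chi x).
  rewrite [chi x]/quad_char; case: eqP => [->|/eqP x0].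
    by rewrite mulr0 quad_char0.
  (* For a nonzero square [x] the two values are -1 and 1; for a non-square, [chi x = -1] and
     [chi (c * x)] is at most 1. *)
  case: existsP => [[y /eqP yx]|_].
    have y0 : y != 0 by apply: contraNneq x0 => y0; rewrite -yx y0 expr0n.
    by rewrite -yx quad_charMsqr // cN1.
  by rewrite /quad_char; case: ifP => // _; case: ifP.
have sum0 : \sum_x - (chi (c * x) + chi x) = 0.
  rewrite sumrN big_split /= sum_quad_char addr0.
  by rewrite (sum_scale _ chi) // sum_quad_char oppr0.
move=> x; move/eqP: sum0; rewrite psumr_eq0 // => /allP /(_ x (mem_index_enum _)).
by rewrite oppr_eq0 addr_eq0 cN1 mulN1r => /eqP.
Qed.

(* x + 1/x = t amounts to (2x - t)^2 = t^2 - 4, which forces x != 0. *)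
Lemma sum_add_inv g :
  \sum_(x : F | x != 0) g (x + x^-1) = \sum_t g t * (1 + chi (t ^+ 2 - 4)).
Proof.
rewrite (partition_big (fun x => x + x^-1) predT) //=.
apply: eq_bigr => t _; rewrite -sum_sqrts big_distrr /=.
rewrite [RHS](reindex_inj (h := fun x => 2 * x - t)) /=; last first.
  by move=> x y /addIr /(mulfI two_neq0).
apply: congr_big => // [x|x /andP[_ /eqP ->]]; last by rewrite mulr1.
have -> : ((2 * x - t) ^+ 2 == t ^+ 2 - 4) = (x ^+ 2 - t * x + 1 == 0).
  rewrite -subr_eq0.
  rewrite (_ : _ - _ = 4 * (x ^+ 2 - t * x + 1)); last by ring.
  by rewrite mulf_eq0 (negPf four_neq0).
(* At 0 the quadratic equals 1, so 0 is no root; elsewhere it is x + 1/x - t multiplied by x. *)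
have [->|x0] := eqVneq x 0; first by rewrite expr0n mulr0 subr0 !add0r oner_eq0.
rewrite -subr_eq0 /= -(mulIr_eq0 _ (mulIf x0)).
by congr (_ == _); field.
Qed.

(** For t != 0, dividing by t^2 and setting u = 1/t leaves chi (4 u + 1). Over all u this sums to 0,
    and the missing u = 0 accounts for chi 1 = 1. *)
Lemma sum_quad_char_sqrD4 : \sum_t chi (t ^+ 2 + 4 * t) = -1.
Proof.
rewrite (bigD1 0) //= expr0n mulr0 addr0 quad_char0 add0r.
under eq_bigr => t t0.
  rewrite (_ : _ + _ = (4 * t^-1 + 1) * t ^+ 2); last by field.
  rewrite quad_charMsqr //; over.
rewrite (sum_neq0_inv (fun u => chi (4 * u + 1))).
rewrite (sum_neq0 (fun u => chi (4 * u + 1))).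
by rewrite (sum_affine _ _ chi) ?four_neq0 // sum_quad_char mulr0 !add0r quad_char1.
Qed.

(** The factor [chi (-1)] turns t^2 - 4 into 4 - t^2, the form that the substitution t -> 4 / t
    produces from the quartic. *)
Lemma sum_quad_char_cubic :
  chi (-1) * \sum_(x | x != 0) chi (x ^+ 3 + x ^+ 2 + x)
  = \sum_t chi ((t + 1) * (4 - t ^+ 2)).
Proof.
under eq_bigr => x x0.
  rewrite (_ : _ + _ = (x + x^-1 + 1) * x ^+ 2); last by field.
  rewrite quad_charMsqr //; over.
rewrite (sum_add_inv (fun t => chi (t + 1))).
under eq_bigr do rewrite mulrDr mulr1 -quad_charM.
rewrite big_split /=.
under eq_bigr do rewrite -[X in X + _]mul1r.
rewrite (sum_affine _ _ chi) ?oner_eq0 // sum_quad_char add0r big_distrr /=.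
by apply: eq_bigr => t _; rewrite -quad_charM; congr chi; ring.
Qed.

Lemma sum_quad_char_quartic :
  \sum_(x | x != 0) chi ((x ^+ 2 + 1) * (x ^+ 2 + 4 * x + 1))
  = \sum_t chi ((t + 1) * (4 - t ^+ 2)) - 2.
Proof.
under eq_bigr => x x0.
  rewrite (_ : _ * _ =
    ((x + x^-1) ^+ 2 + 4 * (x + x^-1)) * x ^+ 2); last by field.
  rewrite quad_charMsqr //; over.
rewrite (sum_add_inv (fun t => chi (t ^+ 2 + 4 * t))).
under eq_bigr do rewrite mulrDr mulr1 -quad_charM.
rewrite big_split /= sum_quad_char_sqrD4.
rewrite [X in _ + X](bigD1 0) //= expr0n mulr0 addr0 mul0r quad_char0 add0r.
under eq_bigr => t t0.
  (* With u = 4 / t, one has 1 + u = (t + 4) / t and 4 - u^2 = 4 (t^2 - 4) / t^2, so the missing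
     factor t^4 / 4 is a square. *)
  rewrite (_ : _ * _ = ((1 + 4 * t^-1) * (4 - (4 * t^-1) ^+ 2)) * (t ^+ 2 / 2) ^+ 2);
    last by field; rewrite t0 two_neq0.
  rewrite quad_charMsqr ?mulf_neq0 ?invr_neq0 ?expf_neq0 //; over.
rewrite (sum_neq0_inv (fun u => chi ((1 + 4 * u) * (4 - (4 * u) ^+ 2)))).
rewrite (sum_neq0 (fun u => chi ((1 + 4 * u) * (4 - (4 * u) ^+ 2)))).
rewrite mulr0 addr0 mul1r expr0n subr0.
(* This excluded term at u = 0 and the -1 from [sum_quad_char_sqrD4] make up the -2. *)
rewrite (_ : chi 4 = 1); last first.
  by rewrite -(quad_char_sqr 2 two_neq0); congr chi; ring.
rewrite (sum_scale _ (fun t => chi ((1 + t) * (4 - t ^+ 2)))) ?four_neq0 //.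
under eq_bigr do rewrite [X in chi (X * _)]addrC.
ring.
Qed.

End QuadraticCharacter.

Lemma dvdz_Fp (p : nat) (n : int) :
  prime p -> (p%:Z %| n)%Z = (n%:~R == 0 :> 'F_p).
Proof.
move=> p_prime; rewrite dvdzE /=.
by rewrite (dvdn_pcharf (pchar_Fp p_prime)); case: (intP n) => //= m;
  rewrite ?NegzE ?mulrNz ?oppr_eq0 ?abszN.
Qed.

(** The bound of the ordinal type behind ['F_p] is computed from the least prime divisor of [p], so
    it agrees with ['I_p] only through primality. The bijection transports both square roots and
    sums. *)
Lemma natr_Fp_bij (p : nat) :
  prime p -> bijective (fun c : 'I_p => (c : nat)%:R : 'F_p).
Proof.
move=> p_prime; apply: inj_card_bij => [c d /(congr1 val)|].
  by rewrite /= !val_Fp_nat // !modn_small //; apply: val_inj.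
by rewrite card_Fp // card_ord.
Qed.

Lemma legendreE (p : nat) (n : int) :
  prime p -> legendre n p = quad_char _ (n%:~R : 'F_p).
Proof.
move=> p_prime; rewrite /legendre /quad_char -dvdz_Fp //.
case: ifP => // _; congr (if _ then _ else _).
have eqF (x : nat) :
    ((x%:Z ^+ 2 == n %[mod p%:Z])%Z) = (x%:R ^+ 2 == n%:~R :> 'F_p).
  by rewrite eqz_mod_dvd dvdz_Fp // rmorphB rmorphXn subr_eq0.
have [h hK Kh] := natr_Fp_bij _ p_prime.
apply/existsP/existsP => -[x ex].
  by exists (x : nat)%:R; rewrite -eqF.
by exists (h x); rewrite eqF (Kh x).
Qed.

Lemma sum_Fp_neq0 (p : nat) (g : 'F_p -> int) : prime p ->
  \sum_(1 <= c < p) g c%:R = \sum_(x : 'F_p | x != 0) g x.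
Proof.
move=> p_prime; rewrite sum_neq0 (reindex _ (onW_bij _ (natr_Fp_bij _ p_prime))) /=.
rewrite -(big_mkord predT (fun c => g c%:R)).
by rewrite [in RHS]big_ltn ?prime_gt0 //= [RHS]addrC addKr.
Qed.

Theorem mainTheorem1 (p : nat) (p_prime : prime p) (p_odd : odd p) :
  legendre (-1) p *
    (\sum_(1 <= c < p) legendre (c%:Z ^+ 3 + c%:Z ^+ 2 + c%:Z) p)
  - \sum_(1 <= b < p)
      legendre ((b%:Z ^+ 2 + 1) * (b%:Z ^+ 2 + 4 * b%:Z + 1)) p
  = 2 :> int.
Proof.
(* Here the oddness of [p] enters: p | 2 would force p = 2. *)
have two_neq0 : 2 != 0 :> 'F_p.
  rewrite -(dvdn_pcharf (pchar_Fp p_prime)) dvdn_prime2 //.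
  by apply: contraTneq p_odd => ->.
under eq_bigr do rewrite legendreE // !rmorphD !rmorphXn /=.
under [X in _ - X]eq_bigr do
  rewrite legendreE // rmorphM !rmorphD rmorphM !rmorphXn /=.
rewrite legendreE //.
rewrite (sum_Fp_neq0 p (fun x => quad_char _ (x ^+ 3 + x ^+ 2 + x))) //.
rewrite (sum_Fp_neq0 p
  (fun x => quad_char _ ((x ^+ 2 + 1) * (x ^+ 2 + 4 * x + 1)))) //.
(* Both terms now involve the same cubic sum S, and the claim becomes S - (S - 2) = 2. *)
rewrite (sum_quad_char_cubic _ two_neq0) (sum_quad_char_quartic _ two_neq0).
ring.
Qed.
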